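(* Let $X$ be a separable Banach space. Assume that the Szlenk index of $X$ satisfies $S_Z(X)>\omega$, where $\omega$ is the first infinite ordinal, and that the dual space $X^*$ has a weak$^*$ unconditional asymptotic structure. Then for every $\varepsilon>0$, every non-trivial countably branching bundle graph, endowed with its graph distance, admits a (bi-)Lipschitz embedding into $X^*$ with distortion less than $6+\varepsilon$.
   Context: Szlenk index. For a weak$^*$-compact $K\subset X^*$ and $\varepsilon>0$, let $s_\varepsilon(K)$ be $K$ minus the union of all weak$^*$-open subsets $V$ of $K$ (relatively open) with $\operatorname{diam}V\le\varepsilon$. Put $s^1_\varepsilon(K)=s_\varepsilon(K)$, $s^{\alpha+1}_\varepsilon(K)=s_\varepsilon(s^\alpha_\varepsilon(K))$, and $s^\alpha_\varepsilon(K)=\bigcap_{\beta<\alpha}s^\beta_\varepsilon(K)$ for limit $\alpha$. Let $S_Z(K,\varepsilon)$ be the least $\alpha$ with $s^\alpha_\varepsilon(K)=\emptyset$ if it exists and $\infty$ otherwise ($\infty$ is larger than every ordinal), and $S_Z(X)=\sup_{\varepsilon>0}S_Z(B_{X^*},\varepsilon)$, where $B_{X^*}$ is the closed unit ball of $X^*$. Weak$^*$ unconditional asymptotic structure. Let $\mathrm{cof}_{w^*}(X^* )$ be the set of weak$^*$-closed subspaces of $X^*$ of finite codimension, and let $S_Y$ denote the unit sphere of $Y$. $X^*$ has a weak$^*$ unconditional asymptotic structure if there is $C\ge1$ such that for every $n\ge1$: $\exists X_1\in\mathrm{cof}_{w^*}(X^* )\ \forall x_1^*\in S_{X_1}\ \cdots\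 \exists X_n\in\mathrm{cof}_{w^*}(X^* )\ \forall x_n^*\in S_{X_n}$: $(x_i^* )_{i=1}^n$ is $C$-unconditional, i.e. $\|\sum\epsilon_ia_ix_i^*\|\le C\|\sum a_ix_i^*\|$ for all scalars $a_i$ and signs $\epsilon_i$. Bundle graphs. A top-bottom graph is a graph with two distinguished vertices, one designated as the top and the other as the bottom. A countably branching bundle graph is a top-bottom graph that can be formed, starting from a path of length $1$, by a finite sequence of the following operations: (i) given two countably branching bundle graphs, identify the top of one with the bottom of the other, the bottom of the first being the new bottom and the top of the second the new top; (ii) take countably infinitely many copies of a countably branching bundle graph and identify all the bottoms with each other and all the tops with each other. It is non-trivial if it is obtained by such a sequence with at least one operation (ii). Distortion. A map $f:(M,d)\to X^*$ has distortion at most $D$ if there is $s>0$ with $s\,d(x,y)\le\|f(x)-f(y)\|\le sD\,d(x,y)$ for all $x,y\in M$. *)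

(* Defs.v *)
From HB Require Import structures.
From mathcomp Require Import all_boot all_order all_algebra.
From mathcomp Require Import all_classical all_reals all_analysis.

Set Implicit Arguments.
Unset Strict Implicit.
Unset Printing Implicit Defensive.

Import Order.TTheory GRing.Theory Num.Theory.
Import numFieldNormedType.Exports.
Local Open Scope classical_set_scope.
Local Open Scope ring_scope.

Definition separable_space (T : topologicalType) : Prop :=
  exists2 A : set T, countable A & dense A.

Section dual.
Context {R : realType} (X : normedModType R).

Definition dual_pred : {pred X -> R^o} :=
  [pred f : X -> R^o | `[< linear f /\ continuous f >]].

Record dual : Type := Dual {
  dual_fun :> X -> R^o;
  dualP : dual_fun \in dual_pred }.

HB.instance Definition _ := [isSub for dual_fun].
HB.instance Definition _ := [Choice of dual by <:].

Lemma dual_linear (f : dual) : linear f.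
Proof. by have /asboolP[] := dualP f. Qed.

Lemma dual_continuous (f : dual) : continuous f.
Proof. by have /asboolP[] := dualP f. Qed.

Fact dual_submod_closed : subsemimod_closed dual_pred.
Proof.
split; first split.
- apply/asboolP; split; last exact: cst_continuous.
  by move=> a x y; rewrite /= scaler0 addr0.
- move=> f g /asboolP[lf cf] /asboolP[lg cg]; apply/asboolP; split.
    by move=> a x y; rewrite !fctE lf lg scalerDr addrACA.
  by move=> x; apply: cvgD; [exact: cf|exact: cg].
- move=> b f /asboolP[lf cf]; apply/asboolP; split.
    move=> a x y; rewrite !fctE lf scalerDr; congr (_ + _).
    by rewrite !scalerA mulrC.
  by move=> x; apply: cvgZl_tmp; exact: cf.
Qed.

HB.instance Definition _ := GRing.isSubmodClosed.Build R (X -> R^o) dual_pred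
  dual_submod_closed.
HB.instance Definition _ := [SubChoice_isSubLmodule of dual by <:].

Definition dual_norm (f : dual) : R :=
  sup [set `|f x| | x in [set x : X | `|x| <= 1]].

Let dual_lin (f : dual) : {linear X -> R^o} :=
  HB.pack (dual_fun f) (GRing.isLinear.Build _ _ _ _ _ (dual_linear f)).

Let dual_has_sup (f : dual) :
  has_sup [set `|f x| | x in [set x : X | `|x| <= 1]].
Proof.
split; first by exists `|f 0|, 0 => //=; rewrite normr0.
have /bounded_funP/(_ 1)[M fM] :
    bounded_near (dual_lin f) (nbhs (0 : X)).
  by apply/linear_bounded_continuous; exact: dual_continuous.
by exists M => _ [x x1 <-]; exact: fM.
Qed.

Let le_dual_norm (f : dual) x : `|x| <= 1 -> `|f x| <= dual_norm f.
Proof. by move=> x1; apply: sup_upper_bound (dual_has_sup f) _ _; exists x. Qed.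

Let dual_norm_le (f : dual) M :
  (forall x, `|x| <= 1 -> `|f x| <= M) -> dual_norm f <= M.
Proof.
move=> fM; apply: ge_sup; first by have [] := dual_has_sup f.
by move=> _ [x x1 <-]; exact: fM.
Qed.

Fact dual_normD f g : dual_norm (f + g) <= dual_norm f + dual_norm g.
Proof.
apply: dual_norm_le => x x1; apply: le_trans (ler_normD _ _) _.
by apply: lerD; exact: le_dual_norm.
Qed.

Fact dual_norm_eq0 f : dual_norm f = 0 -> f = 0.
Proof.
move=> f0; apply/val_inj/funext => x /=.
have lf0 : f 0 = 0 := linear0 (dual_lin f).
have [->//|x0] := eqVneq x 0.
have x1 : `|(`|x|^-1 *: x)| <= 1.
  by rewrite normrZ normfV normr_id mulVf ?normr_eq0.
have fZ : f (`|x|^-1 *: x) = `|x|^-1 *: f x .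
  exact: (linearZ_LR (dual_lin f)).
have := le_dual_norm f x1; rewrite f0 fZ normr_le0 scaler_eq0 invr_eq0.
by rewrite normr_eq0 (negbTE x0) => /eqP.
Qed.

Let dual_normZ_le (l : R) f : dual_norm (l *: f) <= `|l| * dual_norm f.
Proof.
apply: dual_norm_le => x x1; rewrite [_ x]/(l *: f x) normrZ.
by rewrite ler_wpM2l// le_dual_norm.
Qed.

Fact dual_normZ (l : R) f : dual_norm (l *: f) = `|l| * dual_norm f.
Proof.
apply/eqP; rewrite eq_le dual_normZ_le/=.
have [->|l0] := eqVneq l 0.
  rewrite normr0 mul0r; apply: le_trans (le_dual_norm _ (x := 0) _) => //.
  by rewrite normr0.
rewrite -ler_pdivlMl ?normr_gt0// -normfV.
by apply: le_trans (dual_normZ_le _ _); rewrite scalerA mulVf// scale1r.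
Qed.

HB.instance Definition _ :=
  Lmodule_isNormed.Build R dual dual_normD dual_normZ dual_norm_eq0.

(* The weak-star topology is the topology of pointwise convergence on X. *)
Definition weak_star : topologicalType :=
  initial_topology (dual_fun : dual -> {ptws X -> R^o}).

Definition weak_star_open (U : set dual) : Prop := open (U : set weak_star).
Definition weak_star_closed (F : set dual) : Prop := closed (F : set weak_star).

Definition dual_unit_ball : set dual := [set f | `|f| <= 1].

End dual.

(* [olim f] stands for the supremum of the family [f]; the limit ordinals are
   among these suprema. Distinct terms may denote the same ordinal: two ordinals
   are compared by [ole], not by [=]. *)
Inductive ordinal_tree : Type :=
| ozero : ordinal_tree
| osucc : ordinal_tree -> ordinal_tree
| olim : forall I : Type, (I -> ordinal_tree) -> ordinal_tree.

Inductive ole : ordinal_tree -> ordinal_tree -> Prop :=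
| ole_zero b : ole ozero b
| ole_succ a b : ole a b -> ole (osucc a) (osucc b)
| ole_lim a (I : Type) (f : I -> ordinal_tree) i : ole a (f i) -> ole a (olim f)
| olim_le (I : Type) (f : I -> ordinal_tree) b :
    (forall i, ole (f i) b) -> ole (olim f) b.

Definition olt (a b : ordinal_tree) : Prop := ole (osucc a) b.

Definition omega : ordinal_tree := olim (fun n : nat => iter n osucc ozero).

(* [None] is the value oo, larger than every ordinal. *)
Definition ordinal_oo := option ordinal_tree.

Definition olt_oo (a b : ordinal_oo) : Prop :=
  match a, b with
  | Some a, Some b => olt a b
  | Some _, None => True
  | None, _ => False
  end.

Definition osup_oo (I : Type) (f : I -> ordinal_oo) : ordinal_oo :=
  if `[< exists i, f i = None >] then None
  else Some (olim (fun i => odflt ozero (f i))).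

Section szlenk.
Context {R : realType} (X : normedModType R).
Implicit Types (K V : set (dual X)) (e : R).

Definition diam V : \bar R :=
  ereal_sup [set (`|p.1 - p.2|)%:E | p in V `*` V].

Definition rel_weak_star_open K V : Prop :=
  exists2 U, weak_star_open U & V = K `&` U.

Definition szlenk_deriv e K : set (dual X) :=
  K `\` \bigcup_(V in [set V | rel_weak_star_open K V /\ (diam V <= e%:E)%E]) V.

(* In the last clause the intersection runs over a family with supremum
   [olim f], which is cofinal below [olim f] when the latter is a limit ordinal;
   intersecting with [K] only matters for the empty family, for which [olim f]
   denotes the ordinal zero. *)
Fixpoint szlenk_iter e K (a : ordinal_tree) : set (dual X) :=
  match a with
  | ozero => K
  | osucc b => szlenk_deriv e (szlenk_iter e K b)
  | olim J f => K `&` \bigcap_(i in [set: J]) szlenk_iter e K (f i)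
  end.

Definition szlenk_least e K (a : ordinal_tree) : Prop :=
  szlenk_iter e K a = set0 /\
  forall b, szlenk_iter e K b = set0 -> ole a b.

Definition szlenk_at K e : ordinal_oo :=
  match pselect (exists a, szlenk_least e K a) with
  | left ex => Some (projT1 (cid ex))
  | right _ => None
  end.

Definition szlenk_index : ordinal_oo :=
  osup_oo (fun e : {posnum R} => szlenk_at (@dual_unit_ball R X) e%:num).

End szlenk.

Section asymptotic_structure.
Context {R : realType} (X : normedModType R).

Definition linear_subspace (Y : set (dual X)) : Prop :=
  Y 0 /\ forall (a : R) u v, Y u -> Y v -> Y (a *: u + v).

(* The quotient by Y is spanned by the classes of finitely many vectors. *)
Definition finite_codim (Y : set (dual X)) : Prop :=
  exists (k : nat) (b : 'I_k -> dual X), forall u : dual X,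
    exists a : 'I_k -> R, Y (u - \sum_(i < k) a i *: b i).

Definition cof_weak_star : set (set (dual X)) :=
  [set Y | [/\ linear_subspace Y, weak_star_closed Y & finite_codim Y]].

Definition unconditional (C : R) (s : seq (dual X)) : Prop :=
  forall (a : nat -> R) (sgn : nat -> bool),
    `|\sum_(i < size s) (-1) ^+ sgn i *: (a i *: s`_i)|
      <= C * `|\sum_(i < size s) a i *: s`_i|.

(* [asymptotic_game P n s]: exists X_1, forall x_1 in S_{X_1}, ...,
   exists X_n, forall x_n in S_{X_n}, P (s ++ [:: x_1; ...; x_n]). *)
Fixpoint asymptotic_game (P : seq (dual X) -> Prop) (n : nat)
    (s : seq (dual X)) : Prop :=
  if n is m.+1 then
    exists2 Y, cof_weak_star Y &
      forall x, Y x -> `|x| = 1 -> asymptotic_game P m (rcons s x)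
  else P s.

Definition weak_star_unconditional_asymptotic_structure : Prop :=
  exists2 C : R, 1 <= C &
    forall n : nat, (1 <= n)%N -> asymptotic_game (unconditional C) n [::].

End asymptotic_structure.

Inductive tb_vertex (I : Type) : Type :=
| Bottom
| Top
| Inner of I.
Arguments Bottom {I}.
Arguments Top {I}.

(* The vertices are a top, a bottom distinct from it, and the type [inner] of
   all the other ones; [adj] is adjacency. *)
Record tb_graph : Type := TBGraph {
  inner : Type;
  adj : tb_vertex inner -> tb_vertex inner -> Prop }.

Definition vertex (G : tb_graph) : Type := tb_vertex (inner G).

Definition unit_path : tb_graph :=
  @TBGraph void (fun x y => x <> y).

(* [Inner (inl (inr tt))] is the vertex obtained by identifying the top of G1
   with the bottom of G2. *)
Section series_graph.
Variables G1 G2 : tb_graph.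
Let I : Type := (inner G1 + unit + inner G2)%type.

Definition series_lower (x : vertex G1) : tb_vertex I :=
  match x with
  | Bottom => Bottom
  | Top => Inner (inl (inr tt))
  | Inner i => Inner (inl (inl i))
  end.

Definition series_upper (x : vertex G2) : tb_vertex I :=
  match x with
  | Bottom => Inner (inl (inr tt))
  | Top => Top
  | Inner i => Inner (inr i)
  end.

Definition series_graph : tb_graph := @TBGraph I (fun u v =>
  (exists x y, [/\ adj x y, u = series_lower x & v = series_lower y]) \/
  (exists x y, [/\ adj x y, u = series_upper x & v = series_upper y])).

End series_graph.

Section parallel_graph.
Variable G : tb_graph.
Let I : Type := (nat * inner G)%type.

Definition parallel_copy (n : nat) (x : vertex G) : tb_vertex I :=
  match x with
  | Bottom => Bottom
  | Top => Top
  | Inner i => Inner (n, i)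
  end.

Definition parallel_graph : tb_graph := @TBGraph I (fun u v =>
  exists n x y, [/\ adj x y, u = parallel_copy n x & v = parallel_copy n y]).

End parallel_graph.

(* The boolean records whether [parallel_graph] was used at least once. *)
Inductive bundle_construction : bool -> tb_graph -> Prop :=
| bundle_unit_path : bundle_construction false unit_path
| bundle_series b1 b2 G1 G2 :
    bundle_construction b1 G1 -> bundle_construction b2 G2 ->
    bundle_construction (b1 || b2) (series_graph G1 G2)
| bundle_parallel b G :
    bundle_construction b G -> bundle_construction true (parallel_graph G).

Definition nontrivial_bundle_graph (G : tb_graph) : Prop :=
  bundle_construction true G.

Fixpoint walk (G : tb_graph) (n : nat) (x y : vertex G) : Prop :=
  if n is m.+1 then exists2 z, adj x z & walk m z y else x = y.

(* Vertices that no walk connects get the junk value 0; bundle graphs are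
   connected. *)
Definition graph_dist (G : tb_graph) (x y : vertex G) : nat :=
  match pselect (exists n, `[< walk n x y >]) with
  | left ex => ex_minn ex
  | right _ => 0
  end.

Definition distortion_at_most (R : realType) (V : normedModType R)
    (M : Type) (d : M -> M -> R) (f : M -> V) (D : R) : Prop :=
  exists2 s : R, 0 < s & forall x y,
    s * d x y <= `|f x - f y| /\ `|f x - f y| <= s * D * d x y.

(* Main.v *)
From HB Require Import structures.
Require Import Defs.
From mathcomp Require Import all_boot all_order all_algebra.
From mathcomp Require Import all_classical all_reals all_analysis.
From mathcomp Require Import finmap ring lra zify.
Import Order.TTheory GRing.Theory Num.Theory.
Import numFieldNormedType.Exports.
Local Open Scope ring_scope.
Set Implicit Arguments.
Unset Strict Implicit.
Unset Printing Implicit Defensive.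
Local Open Scope classical_set_scope.

(** The idea. A Szlenk index beyond omega means that, for some [r > 0], the
    Szlenk derivatives of the dual ball of every finite order are nonempty.
    Descending through them yields, against any weak-star closed subspaces of
    finite codimension chosen by an opponent, vectors of these subspaces with
    norms bounded below whose sum stays bounded. Unconditionality upgrades the
    bounded sum to an upper c0-estimate with some constant [K]
    ([annihilator_game_c0_bounded]), and James's blocking argument, run on
    strategies instead of sequences, brings the constant down to [1 + d]
    ([annihilator_game_c0_almost_isometric]); this is why the final distortion
    does not depend on the unconditionality constant.

    The game is played with finite sets of points of [X] in place of subspaces:
    a weak-star closed subspace of finite codimension contains the annihilator of
    a finite set ([cof_weak_star_annihilator]), and a functional that is small on
    a finite set is close to its annihilator ([approx_annihilator]). Playing
    along all branches of a countably branching tree of finite depth, against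
    sets that norm what has been chosen so far, gives normalized vectors indexed
    by the tree ([basic_tree_exists]): each branch has an upper c0-estimate with
    constant [1 + d], and each single coordinate is bounded by [2 / (1 - d)]
    times the norm ([basic_tree_coef]).

    On the other side, a bundle graph has natural integer coordinates on such a
    tree ([bundle_construction_coordinates]): the height at the root and, for
    each nested family of parallel copies containing the vertex, the distance to
    the ends of the innermost copy. Along an edge they change by at most 1 on a
    single branch; for two vertices, either the height realizes the distance or
    the paths between them run through an end of the parallel composition where
    they separate, and one coordinate accounts for a third of the distance. Using
    the coordinates as coefficients of the tree gives a map whose Lipschitz
    constant is [1 + d] and whose inverse has constant [2 * 3 / (1 - d)]. *)

(** * Ordinals and the Szlenk derivation *)

(** Matching on both ordinals avoids inverting the equality of dependent pairs
    that [olim] would produce. *)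
Lemma ole_osucc_inv a b : ole a b ->
  match a, b with
  | osucc a', osucc b' => ole a' b'
  | osucc _, olim J f => exists i, ole a (f i)
  | osucc _, ozero => False
  | _, _ => True
  end.
Proof. by case=> // {}a J f i h; case: a h => // a h; exists i. Qed.

Lemma ole_succ_inv a b : ole (osucc a) (osucc b) -> ole a b.
Proof. exact: (@ole_osucc_inv (osucc a) (osucc b)). Qed.

Lemma ole_succ_olim a (I : Type) (f : I -> ordinal_tree) :
  ole (osucc a) (olim f) -> exists i, ole (osucc a) (f i).
Proof. exact: (@ole_osucc_inv (osucc a) (olim f)). Qed.

Lemma ole_olim_inv (I : Type) (f : I -> ordinal_tree) b i :
  ole (olim f) b -> ole (f i) b.
Proof.
suff gen a : ole a b -> if a is olim J g then forall j, ole (g j) b else True.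
  by move=> /gen /(_ i).
elim=> // {b}[{}a J g j _ IH]; case: a IH => // K k IH l.
exact: ole_lim (IH l).
Qed.

Lemma ole_trans b a c : ole a b -> ole b c -> ole a c.
Proof.
move=> h; elim: h c => {a b}.
- by move=> b c _; exact: ole_zero.
- move=> a b _ IH c; move E : (osucc b) => b' h; elim: h E => //.
  + by move=> a' c' ab _ [E]; apply: ole_succ; apply: IH; rewrite E.
  + by move=> a' I f i _ IH' E; exact: ole_lim (IH' E).
- by move=> a I f i _ IH c /(ole_olim_inv i); exact: IH.
- by move=> I f b _ IH c bc; apply: olim_le => i; exact: IH.
Qed.

Definition onat (n : nat) : ordinal_tree := iter n osucc ozero.

Lemma ole_onat_lt n : ~ ole (onat n.+1) (onat n).
Proof.
elim: n => [|n IH] h; first by inversion h.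
by apply: IH; exact: ole_succ_inv h.
Qed.

(** Once some Szlenk derivative of finite order is empty, this keeps the order of
    the first empty one from lying beyond omega. *)
Lemma olt_omega_onat n : ~ olt omega (onat n).
Proof.
case: n => [h|n]; first by inversion h.
move=> /ole_succ_inv /(ole_olim_inv n.+1); exact: ole_onat_lt.
Qed.

Section szlenk_derivation.
Context {R : realType} (X : normedModType R).
Implicit Types (K L : set (dual X)) (r : R).

(** Removes the extended reals from the Szlenk derivation. *)
Lemma diam_leP K r :
  (diam K <= r%:E)%E <-> forall u v, K u -> K v -> `|u - v| <= r.
Proof.
split=> [h u v Ku Kv|h].
  rewrite -lee_fin; apply: le_trans h; apply: ereal_sup_ubound.
  by exists (u, v).
by apply: ge_ereal_sup => _ [[u v] [/= Ku Kv] <-]; rewrite lee_fin; exact: h.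
Qed.

Lemma szlenk_deriv_subset r K : szlenk_deriv r K `<=` K.
Proof. by move=> u []. Qed.

Lemma szlenk_deriv_mono r K L :
  K `<=` L -> szlenk_deriv r K `<=` szlenk_deriv r L.
Proof.
move=> KL u [Ku nu]; split; first exact: KL.
move=> [V [[U oU VE] dV] Vu]; apply: nu; exists (K `&` U).
  split; first by exists U.
  apply/diam_leP => v w [Kv Uv] [Kw Uw]; move/diam_leP: dV; apply.
    by rewrite VE; split=> //; exact: KL.
  by rewrite VE; split=> //; exact: KL.
by split=> //; move: Vu; rewrite VE => -[].
Qed.

Lemma szlenk_iter_decr r K m n : (m <= n)%N ->
  szlenk_iter r K (onat n) `<=` szlenk_iter r K (onat m).
Proof.
move=> /subnKC <-; elim: (n - m)%N => [|k IH]; first by rewrite addn0.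
by rewrite addnS; apply: subset_trans IH; exact: szlenk_deriv_subset.
Qed.

(** Iterates of order below [n] already exhaust all ordinals that are not above
    [n]: at a supremum of such ordinals the decreasing family of finite iterates
    is bounded below by the one of order [n.-1]. This is what makes the first
    [n] with an empty iterate least among all ordinals, not only among the
    integers. *)
Lemma ole_onat_or_szlenk_iter r K b n : ole (onat n) b \/
  exists2 k, (k < n)%N & szlenk_iter r K (onat k) `<=` szlenk_iter r K b.
Proof.
elim: b n => [|b IH|I f IH] [|n]; try by left; exact: ole_zero.
- by right; exists 0%N.
- have [h|[k kn h]] := IH n; first by left; exact: ole_succ.
  by right; exists k.+1 => //; exact: szlenk_deriv_mono.
- have [[i hi]|h] := pselect (exists i, ole (onat n.+1) (f i)).
    by left; exact: ole_lim hi.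
  right; exists n => // u un; split.
    exact: (@szlenk_iter_decr r K 0 n) un.
  move=> i _; have [h'|[k kn]] := IH i n.+1; first by case: h; exists i.
  by apply; exact: szlenk_iter_decr un.
Qed.

(** Guarantees that the index is not infinite merely because no least ordinal
    has been found. *)
Lemma szlenk_least_onat r K n : szlenk_iter r K (onat n) = set0 ->
  exists2 m, (m <= n)%N & szlenk_least r K (onat m).
Proof.
move=> h; have ex : exists m, `[< szlenk_iter r K (onat m) = set0 >].
  by exists n; exact/asboolP.
case: (ex_minnP ex) => m /asboolP m0 mmin; exists m; first by apply: mmin; exact/asboolP.
split=> // b b0; have [//|[k km]] := ole_onat_or_szlenk_iter r K b m.
rewrite b0 subset0 => k0.
by have := mmin k; rewrite leqNgt km => /(_ (asboolT k0)).
Qed.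

Lemma szlenk_index_gt_omega : olt_oo (Some omega) (szlenk_index X) ->
  exists2 r : R, 0 < r &
    forall n, szlenk_iter r (dual_unit_ball (X := X)) (onat n) !=set0.
Proof.
set B := dual_unit_ball (X := X) => h.
suff [r hr] : exists r : {posnum R}, forall a, szlenk_at B r%:num = Some a -> olt omega a.
  exists r%:num => // n; apply: contrapT => /set0P/negP; rewrite negbK => /eqP n0.
  have [m _ hm] := szlenk_least_onat n0.
  move: hr; rewrite /szlenk_at; case: pselect => [ex|[]]; last by exists (onat m).
  case: cid => a [a0 amin] /= /(_ _ erefl) oa.
  by apply: (@olt_omega_onat n); apply: ole_trans oa (amin _ n0).
move: h; rewrite /szlenk_index /osup_oo; case: asboolP => [[r hr] _|_].
  by exists r => a; rewrite hr.
move=> /ole_succ_olim[r hr]; exists r => a ha.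
by move: hr; rewrite ha.
Qed.

(** A point that survives a derivation has, in each of its weak-star
    neighbourhoods, points of the set at distance more than half the removed
    diameter: two points of the neighbourhood are far apart, hence one of them
    is far from the given point. *)
Lemma szlenk_deriv_far r K z (U : set (dual X)) :
  szlenk_deriv r K z -> weak_star_open U -> U z ->
  exists y, [/\ K y, U y & r / 2 < `|y - z|].
Proof.
move=> [Kz nz] oU Uz; apply: contrapT => hn; apply: nz.
exists (K `&` U) => //; split; first by exists U.
have cl y : K y -> U y -> `|y - z| <= r / 2.
  by move=> Ky Uy; rewrite leNgt; apply/negP => hy; apply: hn; exists y.
apply/diam_leP => u v [Ku Uu] [Kv Uv].
rewrite -(subrKA z) (splitr r); apply: le_trans (ler_normD _ _) _.
by apply: lerD; [exact: cl|rewrite distrC; exact: cl].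
Qed.

End szlenk_derivation.

(** * Weak-star neighbourhoods and annihilators of finite sets *)

Section weak_star_annihilators.
Context {R : realType} (X : normedModType R).
Implicit Types (u v w b : dual X) (F : seq X) (Y : set (dual X)).

Lemma dualD u v p : (u + v) p = u p + v p. Proof. by []. Qed.
Lemma dualN u p : (- u) p = - u p. Proof. by []. Qed.
Lemma dualB u v p : (u - v) p = u p - v p. Proof. by []. Qed.
Lemma dualZ a u p : (a *: u) p = a * u p. Proof. by []. Qed.

Lemma dual_ext u v : (forall p, u p = v p) -> u = v.
Proof. by move=> uv; exact/val_inj/funext. Qed.

Lemma dual_sum n (f : 'I_n -> dual X) p :
  (\sum_(i < n) f i) p = \sum_(i < n) f i p.
Proof. by elim/big_ind2: _ => // u x v y <- <-. Qed.

Lemma dual_evalZ u a p : u (a *: p) = a * u p.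
Proof.
pose l : {linear X -> R^o} :=
  HB.pack (dual_fun u) (GRing.isLinear.Build _ _ _ _ _ (dual_linear u)).
exact: (linearZ_LR l).
Qed.

Lemma dual_has_sup u : has_sup [set `|u x| | x in [set x : X | `|x| <= 1]].
Proof.
split; first by exists `|u 0|, 0 => //=; rewrite normr0.
pose l : {linear X -> R^o} :=
  HB.pack (dual_fun u) (GRing.isLinear.Build _ _ _ _ _ (dual_linear u)).
have /bounded_funP/(_ 1)[M uM] : bounded_near l (nbhs (0 : X)).
  by apply/linear_bounded_continuous; exact: dual_continuous.
by exists M => _ [x x1 <-]; exact: uM.
Qed.

Lemma ler_dual_norm u p : `|p| <= 1 -> `|u p| <= `|u|.
Proof. by move=> p1; apply: sup_upper_bound (dual_has_sup u) _ _; exists p. Qed.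

Lemma dual_norming u (t : R) : 0 < t -> exists2 p : X, `|p| <= 1 &
  (1 - t) * `|u| <= `|u p|.
Proof.
move=> t0; have [->|u0] := eqVneq u 0.
  by exists 0; rewrite ?normr0 ?mulr0.
have ut : 0 < t * `|u| by rewrite mulr_gt0 ?normr_gt0.
have [_ [p p1 <-]] := sup_adherent ut (dual_has_sup u).
rewrite -[sup _]/(`|u|) => h; exists p => //; apply: ltW.
by rewrite mulrBl mul1r.
Qed.

Lemma weak_star_open_evals b F (t : R) : 0 < t ->
  weak_star_open [set u : dual X | forall p, p \in F -> `|u p - b p| < t].
Proof.
move=> t0; elim: F => [|p F IH].
  suff -> : [set u : dual X | forall p, p \in [::] -> `|u p - b p| < t] = setT.
    exact: openT.
  by rewrite -subTset => u _ p.
suff -> : [set u : dual X | forall q, q \in p :: F -> `|u q - b q| < t] =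
    [set u : dual X | `|b p - u p| < t] `&`
    [set u : dual X | forall q, q \in F -> `|u q - b q| < t].
  apply: openI IH.
  exists [set g : {ptws X -> R^o} | `|b p - g p| < t] => //.
  have -> : [set g : {ptws X -> R^o} | `|b p - g p| < t] =
      proj p @^-1` (ball (b p : R^o) t) by [].
  apply: open_comp => [g _|]; last exact: ball_open.
  exact: (@proj_continuous X (fun=> R^o : topologicalType) p).
apply/seteqP; split=> u /=.
  move=> h; split; first by rewrite distrC; apply: h; rewrite mem_head.
  by move=> q qF; apply: h; rewrite inE qF orbT.
by move=> [h1 h2] q; rewrite inE => /orP[/eqP->|]; [rewrite distrC|exact: h2].
Qed.

(** A basic neighbourhood for pointwise convergence constrains finitely many
    values, so it contains everything that agrees with its centre there. *)
Lemma weak_star_open_agree U b : weak_star_open U -> U b ->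
  exists F, forall u, (forall p, p \in F -> u p = b p) -> U u.
Proof.
move=> [A oA <-] Ab.
have : nbhs (dual_fun b : {ptws X -> R^o}) A by exact: open_nbhs_nbhs.
move=> [P [[Q QfinP <-] [V JV Vb] sub]].
have [L Lsub VL] := QfinP _ JV.
suff [F hF] : exists F, forall u, (forall p, p \in F -> u p = b p) -> V u.
  by exists F => u /hF Vu; apply: sub; exists V.
have {}Vb M : M \in L -> M b by move=> ML; move: Vb; rewrite -VL; exact.
suff [F hF] : exists F, forall u, (forall p, p \in F -> u p = b p) ->
    forall M, M \in enum_fset L -> M u.
  by exists F => u /hF h; rewrite -VL => M; exact: h.
have {QfinP JV VL sub} Lsub : forall M, M \in (enum_fset L) -> exists p,
    forall u : dual X, u p = b p -> M u.
  move=> M ML; have /set_mem[p _ [N oN NM]] := Lsub _ ML.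
  by exists p => u up; have := Vb M ML; rewrite -NM /= up.
clear Vb; elim: (enum_fset L) Lsub => [|M L' IH] h; first by exists [::].
have [|F hF] := IH; first by move=> N NL; apply: h; rewrite inE NL orbT.
have [p hp] := h M (mem_head _ _).
exists (p :: F) => u hu N; rewrite inE => /orP[/eqP->|NL].
  by apply: hp; apply: hu; rewrite mem_head.
by apply: hF => // q qF; apply: hu; rewrite inE qF orbT.
Qed.

Definition annihilator F : set (dual X) :=
  [set u | forall p, p \in F -> u p = 0].

Lemma annihilator_sub F F' : {subset F <= F'} ->
  annihilator F' `<=` annihilator F.
Proof. by move=> h u hu p /h; exact: hu. Qed.

Lemma annihilator_catl F F' : annihilator (F ++ F') `<=` annihilator F.
Proof. by apply: annihilator_sub => p; rewrite mem_cat => ->. Qed.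

Lemma annihilator_catr F F' : annihilator (F ++ F') `<=` annihilator F'.
Proof. by apply: annihilator_sub => p; rewrite mem_cat orbC => ->. Qed.

Lemma annihilatorD F u v :
  annihilator F u -> annihilator F v -> annihilator F (u + v).
Proof. by move=> hu hv p pF; rewrite dualD hu// hv// addr0. Qed.

Lemma annihilatorZ F a u : annihilator F u -> annihilator F (a *: u).
Proof. by move=> hu p pF; rewrite dualZ hu// mulr0. Qed.

(** The trace of weak-star closedness on finite sets of evaluations: every
    point outside [Y] stays outside [Y + annihilator F] for some finite [F].
    Being algebraic, it passes to [Y] plus a line without any compactness. *)
Definition separated Y := forall b, ~ Y b ->
  exists F, forall y, Y y -> ~ annihilator F (b - y).

Lemma weak_star_closed_separated Y : weak_star_closed Y -> separated Y.
Proof.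
move=> cY b nYb.
have oY : weak_star_open (~` Y) by exact: closed_openC.
have [F hF] := weak_star_open_agree oY nYb.
exists F => y Yy hy; apply: (hF y) => // p pF.
by apply/eqP; rewrite eq_sym -subr_eq0 -dualB hy.
Qed.

(** If [u] belongs to [Y + R b + annihilator F] for every [F], the coefficient
    of [b] is determined as soon as [F] separates [b] from [Y]; it is therefore
    one and the same scalar [a0] for all larger [F], and then separation of [Y]
    itself puts [u - a0 *: b] in [Y]. *)
Lemma separated_line Y b : linear_subspace Y -> separated Y ->
  separated [set u | exists a : R, Y (u - a *: b)].
Proof.
move=> [Y0 Ylin] sY.
have YB u v : Y u -> Y v -> Y (u - v).
  by move=> Yu Yv; rewrite addrC -scaleN1r; exact: Ylin.
have YZ a u : Y u -> Y (a *: u) by move=> Yu; rewrite -[_ *: _]addr0; exact: Ylin.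
have [Yb|nYb] := pselect (Y b).
  move=> u nu; have [|F hF] := sY u.
    by move=> Yu; apply: nu; exists 0; rewrite scale0r subr0.
  exists F => y [a Ya]; apply: hF.
  by rewrite -(subrK (a *: b) y) addrC; exact: Ylin.
have [F0 hF0] := sY b nYb => u nu.
apply: contrapT => /forallNP h.
have {}h F : exists y a, Y y /\ annihilator F (u - (y + a *: b)).
  have /existsNP[y /not_implyP[[a Ya] /contrapT hy]] := h F.
  by exists (y - a *: b), a; rewrite subrK.
have [y0 [a0 [Yy0 h0]]] := h F0.
apply: nu; exists a0; apply: contrapT => /sY[F hF].
have [y [a [Yy hy]]] := h (F0 ++ F).
suff E : a = a0.
  apply: (hF y) => //; rewrite -addrA -opprD (addrC _ y) -E.
  exact: annihilator_catr hy.
apply/eqP; rewrite -subr_eq0; apply/negP => /negP ne.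
apply: (hF0 ((a - a0)^-1 *: (y0 - y))); first by apply: YZ; exact: YB.
have -> : b - (a - a0)^-1 *: (y0 - y) = (a - a0)^-1 *:
    ((u - (y0 + a0 *: b)) + (-1) *: (u - (y + a *: b))).
  apply: (scalerI ne); rewrite scalerBr !scalerA mulfV// !scale1r.
  by apply: dual_ext => p; rewrite !(dualD, dualN, dualZ); ring.
apply: annihilatorZ; apply: annihilatorD => //; apply: annihilatorZ.
exact: annihilator_catl hy.
Qed.

(** Induction on the number of vectors that span the quotient: the last vector
    is absorbed in [Y], and removed again by adding to [F] the points that
    separate it from [Y]. *)
Lemma annihilator_finite_codim k (c : 'I_k -> dual X) Y :
  linear_subspace Y -> separated Y ->
  (forall u, exists a : 'I_k -> R, Y (u - \sum_(i < k) a i *: c i)) ->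
  exists F, annihilator F `<=` Y.
Proof.
elim: k c Y => [|k IH] c Y lY sY hc.
  exists [::] => u _; have [a] := hc u; by rewrite big_ord0 subr0.
have [Y0 Ylin] := lY.
pose b := c ord_max; pose Y' := [set u | exists a : R, Y (u - a *: b)].
have lY' : linear_subspace Y'.
  split; first by exists 0; rewrite scale0r subr0.
  move=> a u v [r hu] [s hv]; exists (a * r + s).
  by rewrite scalerDl opprD addrACA -scalerA -scalerBr; exact: Ylin.
have [|u|F hF] := IH (fun i => c (widen_ord (leqnSn k) i)) Y' lY'.
- exact: separated_line.
- have [a] := hc u; rewrite big_ord_recr /= => ha.
  by exists (fun i => a (widen_ord (leqnSn k) i)), (a ord_max); rewrite -addrA -opprD.
have [Yb|nYb] := pselect (Y b).
  exists F => u /hF[a ha]; rewrite -(subrK (a *: b) u) addrC; exact: Ylin.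
have [F' hF'] := sY b nYb.
exists (F ++ F') => u hu; have [a ha] := hF _ (annihilator_catl hu).
have [a0|a0] := eqVneq a 0; first by move: ha; rewrite a0 scale0r subr0.
case: (hF' (- a^-1 *: (u - a *: b))).
  by rewrite -[_ *: _]addr0; exact: Ylin.
rewrite scalerBr scaleNr scalerA mulNr mulVf// scaleN1r !opprK opprD opprK.
rewrite addrCA subrr addr0; apply: annihilatorZ; exact: annihilator_catr hu.
Qed.

(** Lets every move in the asymptotic game be replaced by a finite set of
    points of the predual. *)
Lemma cof_weak_star_annihilator Y : cof_weak_star Y ->
  exists F, annihilator F `<=` Y.
Proof.
move=> [lY cY [k [c hc]]]; apply: annihilator_finite_codim lY _ hc.
exact: weak_star_closed_separated.
Qed.

(** A functional that is small on a finite set is norm-close to one vanishing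
    there; points are treated one at a time, correcting by a multiple of a
    functional [g] that vanishes on the points already treated but not at the
    new one. This replaces the extraction of weak-star null sequences. *)
Lemma approx_annihilator F : exists2 M : R, 0 <= M & forall u,
  exists2 v, annihilator F v & `|u - v| <= M * \sum_(p <- F) `|u p|.
Proof.
elim: F => [|p F [M M0 hM]].
  by exists 0 => // u; exists u => //; rewrite subrr normr0 mul0r.
have S0 u : 0 <= \sum_(q <- F) `|u q| by apply: sumr_ge0.
have [h|/existsNP[g /not_implyP[Fg gp0]]] :=
    pselect (forall v, annihilator F v -> v p = 0).
  exists M => // u; have [v Fv uv] := hM u; exists v.
    by move=> q; rewrite inE => /orP[/eqP->|]; [exact: h|exact: Fv].
  apply: le_trans uv _; rewrite big_cons; apply: ler_wpM2l => //.
  by rewrite lerDr.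
have {}gp0 : g p != 0 by exact/eqP.
pose c := `|(g p)^-1 *: g|; have c0 : 0 <= c by exact: normr_ge0.
exists (M + c * (1 + (`|p| + 1) * M)).
  by rewrite addr_ge0// mulr_ge0// addr_ge0// mulr_ge0// addr_ge0.
move=> u; have [v Fv uv] := hM u.
exists (v - v p *: ((g p)^-1 *: g)).
  move=> q; rewrite inE => /orP[/eqP->|qF].
    by rewrite dualB !dualZ mulVf// mulr1 subrr.
  by rewrite dualB !dualZ (Fv q qF) (Fg q qF) !mulr0 subr0.
set S := \sum_(q <- F) `|u q| in uv.
have vp : `|v p| <= `|u p| + (`|p| + 1) * (M * S).
  have -> : v p = u p - (u - v) p by rewrite dualB; ring.
  apply: le_trans (ler_normB _ _) _; rewrite lerD2l.
  have pp : 0 < `|p| + 1 by rewrite ltr_wpDl.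
  have -> : (u - v) p = (`|p| + 1) * (u - v) ((`|p| + 1)^-1 *: p).
    by rewrite dual_evalZ mulrA mulfV ?gt_eqF// mul1r.
  rewrite normrM (gtr0_norm pp) ler_pM2l//; apply: le_trans uv.
  apply: ler_dual_norm; rewrite normrZ normfV (gtr0_norm pp).
  by rewrite mulrC ler_pdivrMr// mul1r lerDl.
rewrite opprD opprK addrA; apply: le_trans (ler_normD _ _) _.
rewrite normrZ -/c big_cons -/S.
have Sp : 0 <= S by exact: S0.
have up : 0 <= `|u p| by [].
have : `|v p| * c <= (`|u p| + (`|p| + 1) * (M * S)) * c by exact: ler_wpM2r.
have : 0 <= c * `|p| * M * `|u p| by rewrite !mulr_ge0.
have : 0 <= c * M * `|u p| by rewrite !mulr_ge0.
have : 0 <= M * `|u p| by rewrite !mulr_ge0.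
have : 0 <= c * S by rewrite !mulr_ge0.
move: uv; set U := `|u - v|; set V := `|v p|; set q := `|p|; set z := `|u p|.
nra.
Qed.

End weak_star_annihilators.

(** * Asymptotic games: c0-behaviour and James blocking *)

Section annihilator_games.
Context {R : realType} (X : normedModType R).
Implicit Types (u v w x : dual X) (F : seq X) (s t r : seq (dual X)).
Implicit Types (a b c : nat -> R) (P Q : seq (dual X) -> Prop).

(** The game of the asymptotic structure seen from the other player: whatever
    the finite sets of points, unit vectors of their annihilators can be chosen
    one after the other so that [P] holds in the end. *)
Fixpoint annihilator_game P (n : nat) s : Prop :=
  if n is m.+1 then
    forall F, exists x,
      [/\ annihilator F x, `|x| = 1 & annihilator_game P m (rcons s x)]
  else P s.

Definition lincomb a s : dual X := \sum_(i < size s) a i *: s`_i.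

Lemma lincomb_nil a : lincomb a [::] = 0.
Proof. by rewrite /lincomb big_ord0. Qed.

Lemma lincomb_cons a x s :
  lincomb a (x :: s) = a 0%N *: x + lincomb (fun i => a i.+1) s.
Proof. by rewrite /lincomb big_ord_recl. Qed.

Lemma eq_lincomb a b s : (forall i, (i < size s)%N -> a i = b i) ->
  lincomb a s = lincomb b s.
Proof. by move=> ab; apply: eq_bigr => i _; rewrite ab. Qed.

Lemma lincomb_cat a s t : lincomb a (s ++ t) =
  lincomb a s + lincomb (fun i => a (size s + i)%N) t.
Proof.
elim: s a => [|x s IH] a; first by rewrite lincomb_nil add0r.
by rewrite cat_cons !lincomb_cons IH addrA.
Qed.

Lemma lincomb_rcons a s x :
  lincomb a (rcons s x) = lincomb a s + a (size s) *: x.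
Proof. by rewrite -cats1 lincomb_cat lincomb_cons lincomb_nil addr0 addn0. Qed.

Lemma lincombZ a (k : R) s : lincomb (fun i => k * a i) s = k *: lincomb a s.
Proof. by rewrite /lincomb scaler_sumr; apply: eq_bigr => i _; rewrite scalerA. Qed.

Lemma lincomb_annihilator F a s :
  (forall x, x \in s -> annihilator F x) -> annihilator F (lincomb a s).
Proof.
elim: s a => [|x s IH] a h; first by rewrite lincomb_nil.
rewrite lincomb_cons; apply: annihilatorD.
  by apply: annihilatorZ; apply: h; rewrite mem_head.
by apply: IH => y ys; apply: h; rewrite inE ys orbT.
Qed.

(** The upper half of the equivalence with the unit vector basis of c0; the
    lower half comes for free from the vectors annihilating norming sets. *)
Definition c0_upper (K : R) s : Prop :=
  forall a, (forall i, `|a i| <= 1) -> `|lincomb a s| <= K.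

(** [w + q *: v] is a convex combination of [w + v] and [w - v]. *)
Lemma norm_convex_signs w v (M q : R) : `|q| <= 1 ->
  `|w + v| <= M -> `|w - v| <= M -> `|w + q *: v| <= M.
Proof.
rewrite ler_norml => /andP[q1 q2] h1 h2.
have -> : w + q *: v = ((1 + q) / 2) *: (w + v) + ((1 - q) / 2) *: (w - v).
  by apply: dual_ext => p; rewrite !(dualD, dualN, dualZ); field.
apply: le_trans (ler_normD _ _) _; rewrite (normrZ _ (w + v)) (normrZ _ (w - v)).
have q1p : 0 <= (1 + q) / 2 by lra.
have q2p : 0 <= (1 - q) / 2 by lra.
rewrite (ger0_norm q1p) (ger0_norm q2p).
by move: (ler_wpM2l q1p h1) (ler_wpM2l q2p h2); lra.
Qed.

(** The norm is convex, so its maximum over a cube is attained at a vertex; the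
    translation [w] carries the coordinates already treated. *)
Lemma c0_upper_signs c s (M : R) w :
  (forall sgn : nat -> bool,
    `|w + lincomb (fun i => (-1) ^+ sgn i * c i) s| <= M) ->
  forall b, (forall i, `|b i| <= 1) ->
    `|w + lincomb (fun i => b i * c i) s| <= M.
Proof.
elim: s c w => [|x s IH] c w h b b1.
  by move: (h (fun=> false)); rewrite !lincomb_nil.
rewrite lincomb_cons addrA.
apply: (IH (fun i => c i.+1) _ _ (fun i => b i.+1)) => // sgn.
rewrite addrAC -scalerA; apply: norm_convex_signs => //.
  rewrite -addrA (addrC (lincomb _ _)).
  have := h (fun i => if i is j.+1 then sgn j else false).
  by rewrite lincomb_cons expr0 mul1r.
rewrite -addrA (addrC (lincomb _ _)).
have := h (fun i => if i is j.+1 then sgn j else true).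
by rewrite lincomb_cons expr1 mulN1r scaleNr.
Qed.

Lemma unconditional_c0_upper C s c (M t : R) : 0 < t ->
  unconditional C s -> (forall i, t <= c i) ->
  C * `|lincomb c s| <= M -> c0_upper (M / t) s.
Proof.
move=> t0 Cs ct hM a a1.
have c0 i : 0 < c i by exact: lt_le_trans (ct i).
have -> : lincomb a s = t^-1 *: lincomb (fun i => (t * a i / c i) * c i) s.
  rewrite -lincombZ; apply: eq_lincomb => i _; rewrite divfK ?gt_eqF//.
  by rewrite mulrA mulVf ?gt_eqF// mul1r.
rewrite normrZ gtr0_norm ?invr_gt0// mulrC ler_pM2r ?invr_gt0//.
rewrite -[lincomb _ _]add0r; apply: c0_upper_signs => [sgn|i].
  rewrite add0r; apply: le_trans hM.
  have := Cs c sgn; congr (`|_| <= _).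
  by apply: eq_bigr => i _; rewrite scalerA.
rewrite normrM normfV (gtr0_norm (c0 i)) ler_pdivrMr// mul1r.
rewrite normrM (gtr0_norm t0); apply: le_trans (ct i).
by rewrite ler_piMr// ltW.
Qed.

(** Walking down the Szlenk derivatives: from a point of the derivative of order
    [n.+1], [szlenk_deriv_far] gives a point of the one of order [n] that is
    weak-star close but at distance more than [r / 2]. The increment is moved
    into the prescribed annihilator at a cost [h] and normalized, [c] recording
    the norms. The increments add up to a difference of two points of the unit
    ball, up to [N * h <= 1], so they have a sum of norm at most 3, and the
    unconditionality won in the given game turns this one sum into a bound for
    all of them. *)
Lemma szlenk_game (r C h : R) (N : nat) (z0 : dual X) n s z c :
  0 < r -> 1 <= C -> 0 < h -> h <= r / 4 ->
  N%:R * h <= 1 -> (size s + n)%N = N ->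
  `|z0| <= 1 ->
  szlenk_iter r (dual_unit_ball (X := X)) (onat n) z ->
  (forall i, r / 4 <= c i) ->
  `|z - z0 - lincomb c s| <= (size s)%:R * h ->
  asymptotic_game (unconditional C) n s ->
  annihilator_game (c0_upper (C * 3 / (r / 4))) n s.
Proof.
move=> r0 C1 h0 hr Nh sN z01.
elim: n s z c sN => [|n IH] s z c sN zn hc zs gs.
  apply: (@unconditional_c0_upper C s c) => //; first by rewrite divr_gt0.
  apply: ler_wpM2l; first by apply: le_trans C1.
  have -> : lincomb c s = - (z - z0 - lincomb c s) + z - z0.
    by apply: dual_ext => p; rewrite !(dualD, dualN); ring.
  rewrite addn0 in sN; rewrite sN in zs.
  have z1 : `|z| <= 1 by [].
  apply: le_trans (ler_normB _ _) _; apply: le_trans (lerD (ler_normD _ _) (lexx _)) _.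
  by rewrite normrN; lra.
have [Y cY hY] := gs => F.
have [F' hF'] := cof_weak_star_annihilator cY.
have [M M0 hM] := approx_annihilator (F ++ F').
pose l : R := (size (F ++ F'))%:R.
have l0 : 0 <= l by [].
(* Makes the correction [M * (l * d)] at most [h]. *)
pose d := h / (M * l + 1).
have Ml : 0 <= M * l by exact: mulr_ge0.
have Ml1 : 0 < M * l + 1 by rewrite ltr_wpDl.
have d0 : 0 < d by rewrite divr_gt0.
have oU := weak_star_open_evals z (F ++ F') d0.
have [|y [yn hy zy]] := szlenk_deriv_far zn oU.
  by move=> p _; rewrite subrr normr0.
have [u Fu hu] := hM (y - z).
have uh : `|y - z - u| <= h.
  apply: le_trans hu _.
  have : \sum_(p <- F ++ F') `|(y - z) p| <= l * d.
    rewrite /l -sum1_size natr_sum mulr_suml big_seq [leRHS]big_seq.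
    by apply: ler_sum => p pF; rewrite mul1r dualB; apply: ltW; exact: hy.
  move=> /(ler_wpM2l M0) /le_trans; apply.
  rewrite /d !mulrA ler_pdivrMr//; nra.
have ur : r / 4 <= `|u|.
  have : `|y - z| <= `|y - z - u| + `|u| by rewrite -{1}(subrK u (y - z)); exact: ler_normD.
  lra.
have u0 : 0 < `|u| by apply: lt_le_trans ur; rewrite divr_gt0.
pose x := `|u|^-1 *: u.
have x1 : `|x| = 1 by rewrite normrZ normfV normr_id mulVf ?gt_eqF.
have Fx : annihilator (F ++ F') x by exact: annihilatorZ.
exists x; split=> //; first exact: annihilator_catl Fx.
apply: (IH _ y (fun i => if (i < size s)%N then c i else `|u|)) => //.
- by rewrite size_rcons addSnnS.
- by move=> i; case: ifP.
- rewrite lincomb_rcons ltnn scalerA mulfV ?gt_eqF// scale1r size_rcons.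
  rewrite (@eq_lincomb _ c); last by move=> i ->.
  have -> : y - z0 - (lincomb c s + u) = (z - z0 - lincomb c s) + (y - z - u).
    by apply: dual_ext => p; rewrite !(dualD, dualN); ring.
  by apply: le_trans (ler_normD _ _) _; rewrite -natr1 mulrDl mul1r; exact: lerD.
- by apply: hY => //; apply: hF'; exact: annihilator_catr Fx.
Qed.

Lemma annihilator_game_c0_bounded :
  olt_oo (Some omega) (szlenk_index X) ->
  weak_star_unconditional_asymptotic_structure X ->
  exists K : R, forall n, (0 < n)%N -> annihilator_game (c0_upper K) n [::].
Proof.
move=> /szlenk_index_gt_omega[r r0 hr] [C C1 hC].
exists (C * 3 / (r / 4)) => n n0.
have [z zn] := hr n.
have r4 : 0 < r / 4 by rewrite divr_gt0.
pose h := Num.min (r / 4) (n%:R^-1).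
have h0 : 0 < h by rewrite lt_min r4 invr_gt0 ltr0n.
have hr4 : h <= r / 4 by rewrite ge_min lexx.
have hn : n%:R * h <= 1.
  by rewrite -ler_pdivlMl ?ltr0n// mulr1 ge_min lexx orbT.
apply: (@szlenk_game r C h n z n [::] z (fun=> r / 4)) => //.
- exact: (@szlenk_iter_decr _ _ r _ 0 n) zn.
- by rewrite subrr lincomb_nil subr0 normr0 mul0r.
- exact: hC.
Qed.

(** When [P] cannot be reached from [t] in [m] moves, the opponent has a
    strategy against it; following this strategy, while imposing [F] as well,
    during the first [m] moves of a longer game that is being won produces a
    block inside [annihilator F] that violates [P], after which the longer game
    is still won. *)
Lemma annihilator_game_block P Q m k F s t :
  annihilator_game Q (m + k) s -> ~ annihilator_game P m t ->
  exists r, [/\ size r = m, forall x, x \in r -> annihilator F x,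
    ~ P (t ++ r) & annihilator_game Q k (s ++ r)].
Proof.
elim: m s t => [|m IH] s t /=.
  by move=> gQ gP; exists [::]; rewrite !cats0; split.
move=> gQ /existsNP[F' hF'].
have [x [Fx x1 gx]] := gQ (F ++ F').
have [|r [sr hr nP gr]] := IH _ (rcons t x) gx.
  move=> gt; apply: hF'; exists x; split=> //; exact: annihilator_catr Fx.
exists (x :: r); rewrite -!cat_rcons; split=> //=; first by rewrite sr.
move=> y; rewrite inE => /orP[/eqP->|]; [exact: annihilator_catl Fx|exact: hr].
Qed.

(** The list [t] consists of successive blocks of [s] with coefficients at most
    [k]: only the effect on combinations of [t] is recorded. *)
Definition blocking (k : R) s t : Prop :=
  forall b, (forall i, `|b i| <= 1) ->
    exists2 a, (forall i, `|a i| <= k) & lincomb b t = lincomb a s.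

Lemma blocking_rcons (q : R) s t r a0 : 0 < q ->
  (forall i, `|a0 i| <= 1) -> q <= `|lincomb a0 r| ->
  blocking q^-1 s t ->
  blocking q^-1 (s ++ r) (rcons t (`|lincomb a0 r|^-1 *: lincomb a0 r)).
Proof.
set y := lincomb a0 r => q0 a01 hq st b b1.
have y0 : 0 < `|y| by exact: lt_le_trans hq.
have [a ha ea] := st b b1.
exists (fun i => if (i < size s)%N then a i
  else (b (size t) * `|y|^-1) * a0 (i - size s)%N).
  move=> i; case: ifP => // _.
  rewrite 2!normrM (ger0_norm (x := `|y|^-1)) ?invr_ge0//.
  apply: (@le_trans _ _ (`|y|^-1)); last by rewrite lef_pV2.
  by rewrite -[leRHS]mulr1 ler_pM// ?mulr_ge0 ?invr_ge0// ler_piMl ?invr_ge0.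
rewrite lincomb_rcons lincomb_cat ea; congr (_ + _).
  by apply: eq_lincomb => i ->.
rewrite scalerA -[y]/(lincomb a0 r) -lincombZ; apply: eq_lincomb => i _.
by rewrite ltnNge leq_addr addKn.
Qed.

(** The step of James's distortion argument for c0. A block that is not
    [c0_upper q] carries a combination of norm more than [q] with coefficients
    at most 1. Normalizing it divides the coefficients by [q], so a c0-estimate
    for the whole list improves by the factor [q] on the normalized blocks. *)
Lemma annihilator_game_blocking (K q : R) m n s t : 0 < q ->
  ~ annihilator_game (c0_upper q) m [::] ->
  blocking q^-1 s t ->
  annihilator_game (c0_upper K) (n * m) s ->
  annihilator_game (c0_upper (K / q)) n t.
Proof.
move=> q0 hm; elim: n s t => [|n IH] s t st /=.
  move=> hs b b1; have [a ha ->] := st b b1.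
  have -> : lincomb a s = q^-1 *: lincomb (fun i => q * a i) s.
    by rewrite lincombZ scalerA mulVf ?gt_eqF// scale1r.
  rewrite normrZ gtr0_norm ?invr_gt0// mulrC ler_pM2r ?invr_gt0//.
  apply: hs => i; rewrite normrM (gtr0_norm q0).
  by rewrite -ler_pdivlMl// mulr1.
rewrite mulSn => gs F.
have [r [_ hr /existsNP[a /not_implyP[a1 /negP]]]] := annihilator_game_block F gs hm.
rewrite cat0s -ltNge => qa gr.
have y0 : 0 < `|lincomb a r| by exact: lt_trans qa.
exists (`|lincomb a r|^-1 *: lincomb a r); split.
- by apply: annihilatorZ; exact: lincomb_annihilator.
- by rewrite normrZ normfV normr_id mulVf ?gt_eqF.
- by apply: IH gr; apply: blocking_rcons => //; exact: ltW.
Qed.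

(** If the constant [1 + d] failed at one length, blocking would divide any
    available constant by [1 + d] as often as desired, below 1 in the end,
    although the vectors are normalized. *)
Lemma annihilator_game_c0_almost_isometric (K d : R) : 0 < d ->
  (forall n, (0 < n)%N -> annihilator_game (c0_upper K) n [::]) ->
  forall m, (0 < m)%N -> annihilator_game (c0_upper (1 + d)) m [::].
Proof.
move=> d0 hK m m0; apply: contrapT => nm.
pose q := 1 + d; have q0 : 0 < q by rewrite addr_gt0.
have iter_q j : forall n, (0 < n)%N -> annihilator_game (c0_upper (K / q ^+ j)) n [::].
  elim: j => [|j IH] n n0; first by rewrite expr0 divr1; exact: hK.
  rewrite exprSr invfM mulrA; apply: (@annihilator_game_blocking _ _ m n [::]) => //.
    by move=> b _; exists (fun=> 0) => [i|]; rewrite ?normr0 ?invr_ge0 ?(ltW q0)// !lincomb_nil.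
  by apply: IH; rewrite muln_gt0 n0.
have [j hj] : exists j, K < q ^+ j.
  pose j := Num.Def.archi_bound (`|K| / d); exists j.
  have : `|K| / d < j%:R by apply: archi_boundP; rewrite divr_ge0// ltW.
  rewrite ltr_pdivrMr// => Kj.
  apply: le_lt_trans (ler_norm K) _; apply: lt_le_trans Kj _.
  (* Bernoulli's inequality. *)
  have : 1 + j%:R * d <= q ^+ j.
    elim: (j) => [|i IH]; first by rewrite mul0r addr0 expr0.
    have i0 : 0 <= i%:R :> R by [].
    rewrite exprS -natr1 /q; have : 0 <= (1 + d) * (q ^+ i - (1 + i%:R * d)).
      by apply: mulr_ge0; [exact: ltW q0|rewrite subr_ge0].
    rewrite /q; set z := (1 + d) ^+ i; nra.
  by move: (j%:R * d) => z; lra.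
have [x [_ x1 hx]] := iter_q j 1%N isT [::].
have {}hx := hx (fun=> 1) (fun=> ltac:(by rewrite normr1)); move: hx.
rewrite lincomb_cons lincomb_nil addr0 scale1r x1 ler_pdivlMr ?exprn_gt0//.
by rewrite mul1r leNgt hj.
Qed.

End annihilator_games.

(** * Coordinates on bundle graphs *)

Section bundle_coordinates.
Local Open Scope nat_scope.

Lemma mkseq_cons (T : Type) (f : nat -> T) n :
  mkseq f n.+1 = f 0 :: mkseq (f \o succn) n.
Proof. by rewrite /mkseq /= -[1]addn0 iotaDl -map_comp. Qed.

Lemma walk_cat (G : tb_graph) m n (x y z : vertex G) :
  walk m x y -> walk n y z -> walk (m + n) x z.
Proof. by elim: m x => [|m IH] x /=; [move=> -> | case=> v xv /IH h /h; exists v]. Qed.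

Lemma walk_rev (G : tb_graph) m (x y : vertex G) :
  (forall u v : vertex G, adj u v -> adj v u) -> walk m x y -> walk m y x.
Proof.
move=> sym; elim: m x => [|m IH] x; first by move=> /= ->.
case=> v xv /IH h; rewrite -addn1; apply: walk_cat h _.
by exists x => //; exact: sym.
Qed.

Lemma walk_map (G G' : tb_graph) (f : vertex G -> vertex G') m x y :
  (forall u v, adj u v -> adj (f u) (f v)) -> walk m x y -> walk m (f x) (f y).
Proof.
move=> hf; elim: m x => [|m IH] x /=; first by move=> ->.
by case=> v xv /IH h; exists (f v) => //; exact: hf.
Qed.

(** A map of a bundle graph into the finitely supported integer functions on the
    tree of finite sequences of integers. At the root, [w x] is the height of
    [x] above the bottom. A sequence of length [k] is a choice of copies in [k]
    nested parallel compositions, and [w x] is there the smaller of the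
    distances of [x] to the two ends of the last of them if [x] lies in the
    chosen copies, and 0 otherwise. The differences along an edge are at most 1
    and live on a single branch [L] ([coord_adj]), while some coordinate detects
    a third of the distance ([coord_walk]); [k <= 3 * _] bounds the length of a
    walk, hence the distance. *)
Record bundle_coordinates (G : tb_graph) (w : vertex G -> seq nat -> nat)
    (H D : nat) : Prop := BundleCoordinates {
  coord_bottom : forall t, w Bottom t = 0;
  coord_top : forall t, w Top t = if t is [::] then H else 0;
  coord_le : forall x t, w x t <= H;
  coord_depth : forall x t, w x t != 0 -> size t <= D;
  coord_finite : forall x, exists s : seq (seq nat), forall t, w x t != 0 -> t \in s;
  coord_adj_sym : forall x y : vertex G, adj x y -> adj y x;
  coord_adj : forall x y, adj x y -> exists L : nat -> nat, forall t,
    [/\ w x t <= (w y t).+1, w y t <= (w x t).+1 &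
      w x t != w y t -> t = mkseq L (size t)];
  coord_walk_bottom : forall x, walk (w x [::]) Bottom x;
  coord_walk_top : forall x, walk (H - w x [::]) x Top;
  coord_walk : forall x y, exists k t, walk k x y /\
    k <= 3 * ((w x t - w y t) + (w y t - w x t)) }.

Lemma unit_path_coordinates :
  bundle_coordinates (fun (x : vertex unit_path) t =>
    if t is [::] then if x is Top then 1 else 0 else 0) 1 0.
Proof.
split.
- by case.
- by case.
- by case=> [||[]] [|? ?].
- by case=> [||[]] [|? ?].
- by move=> x; exists [:: [::]] => -[].
- by move=> x y /= xy /esym.
- move=> x y xy; exists (fun=> 0) => t; split; case: t => // [].
  + by case: x {xy} => [||[]].
  + by case: y {xy} => [||[]].
- by case=> [||[]] //; exists Top.
- by case=> [||[]] //; exists Top.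
- case=> [||[]] [||[]].
  + by exists 0, [::].
  + by exists 1, [::]; split=> //; exists Top.
  + by exists 1, [::]; split=> //; exists Bottom.
  + by exists 0, [::].
Qed.

Section series.
Variables (G1 G2 : tb_graph) (H1 H2 D1 D2 : nat).
Variables (w1 : vertex G1 -> seq nat -> nat) (w2 : vertex G2 -> seq nat -> nat).
Hypotheses (hw1 : bundle_coordinates w1 H1 D1) (hw2 : bundle_coordinates w2 H2 D2).

(** Stacks the upper graph at height [H]: only the root coordinate changes. *)
Definition shift_coord (H : nat) (f : seq nat -> nat) (t : seq nat) : nat :=
  if t is [::] then H + f [::] else f t.

Definition series_coord (v : vertex (series_graph G1 G2)) : seq nat -> nat :=
  match v with
  | Bottom => w1 Bottom
  | Top => shift_coord H1 (w2 Top)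
  | Inner (inl (inl i)) => w1 (Inner i)
  | Inner (inl (inr tt)) => w1 Top
  | Inner (inr i) => shift_coord H1 (w2 (Inner i))
  end.

Lemma series_coord_lower x t : series_coord (series_lower G2 x) t = w1 x t.
Proof. by case: x. Qed.

Lemma series_coord_upper x t :
  series_coord (series_upper G1 x) t = shift_coord H1 (w2 x) t.
Proof.
case: x => //=; rewrite (coord_top hw1) /shift_coord.
by case: t => [|? ?]; rewrite (coord_bottom hw2) ?addn0.
Qed.

Lemma series_vertexP (v : vertex (series_graph G1 G2)) :
  (exists x, v = series_lower G2 x) \/ (exists x, v = series_upper G1 x).
Proof.
case: v => [||[[i|[]]|i]].
- by left; exists Bottom.
- by right; exists Top.
- by left; exists (Inner i).
- by left; exists Top.
- by right; exists (Inner i).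
Qed.

Lemma series_walk_lower k x y : walk k x y ->
  walk k (series_lower G2 x : vertex (series_graph G1 G2)) (series_lower G2 y).
Proof. by apply: walk_map => u v uv; left; exists u, v. Qed.

Lemma series_walk_upper k x y : walk k x y ->
  walk k (series_upper G1 x : vertex (series_graph G1 G2)) (series_upper G1 y).
Proof. by apply: walk_map => u v uv; right; exists u, v. Qed.

Lemma series_adj_sym (x y : vertex (series_graph G1 G2)) : adj x y -> adj y x.
Proof.
by case=> -[u [v [uv -> ->]]]; [left|right]; exists v, u; split=> //;
  [exact: coord_adj_sym hw1 _ _ uv|exact: coord_adj_sym hw2 _ _ uv].
Qed.

Lemma series_walk_across x y :
  walk ((H1 - w1 x [::]) + w2 y [::])
    (series_lower G2 x : vertex (series_graph G1 G2)) (series_upper G1 y).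
Proof.
apply: walk_cat (series_walk_lower (coord_walk_top hw1 x)) _.
exact: series_walk_upper (coord_walk_bottom hw2 y).
Qed.

Lemma series_coordinates :
  bundle_coordinates series_coord (H1 + H2) (maxn D1 D2).
Proof.
split.
- exact: coord_bottom hw1.
- by case=> [|n t] /=; rewrite (coord_top hw2).
- move=> v t; case: (series_vertexP v) => -[x ->].
    by rewrite series_coord_lower (leq_trans (coord_le hw1 x t)) ?leq_addr.
  rewrite series_coord_upper; case: t => [|n t] /=; first by rewrite leq_add2l (coord_le hw2).
  by rewrite (leq_trans (coord_le hw2 x _)) ?leq_addl.
- move=> v t; rewrite leq_max; case: (series_vertexP v) => -[x ->].
    by rewrite series_coord_lower => /(coord_depth hw1) ->.
  rewrite series_coord_upper; case: t => [|n t] //= /(coord_depth hw2) ->.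
  by rewrite orbT.
- move=> v; case: (series_vertexP v) => -[x ->].
    have [s hs] := coord_finite hw1 x; exists s => t.
    by rewrite series_coord_lower; exact: hs.
  have [s hs] := coord_finite hw2 x; exists ([::] :: s) => t.
  by rewrite series_coord_upper inE; case: t => [|n t] //= /hs.
- exact: series_adj_sym.
- move=> _ _ [] [x [y [xy -> ->]]].
    have [L hL] := coord_adj hw1 xy; exists L => t.
    by rewrite !series_coord_lower.
  have [L hL] := coord_adj hw2 xy; exists L => t.
  by rewrite !series_coord_upper; case: t (hL t) => [|n t] //= [? ? _]; split=> //; lia.
- move=> v; case: (series_vertexP v) => -[x ->].
    rewrite series_coord_lower; exact: series_walk_lower (coord_walk_bottom hw1 x).
  rewrite series_coord_upper /= -[H1]subn0 -(coord_bottom hw1 [::]).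
  exact: series_walk_across.
- move=> v; case: (series_vertexP v) => -[x ->].
    have := series_walk_across x Top; rewrite series_coord_lower (coord_top hw2).
    by have := coord_le hw1 x [::]; move=> h; congr (walk _ _ _); lia.
  rewrite series_coord_upper /= subnDl.
  exact: series_walk_upper (coord_walk_top hw2 x).
- move=> u v; case: (series_vertexP u) => -[x ->]; case: (series_vertexP v) => -[y ->].
  + have [k [t [kxy kt]]] := coord_walk hw1 x y; exists k, t.
    by rewrite !series_coord_lower; split=> //; exact: series_walk_lower.
  + exists ((H1 - w1 x [::]) + w2 y [::]), [::]; split; first exact: series_walk_across.
    rewrite series_coord_lower series_coord_upper /=.
    by have := coord_le hw1 x [::]; lia.
  + exists ((H1 - w1 y [::]) + w2 x [::]), [::]; split.
      apply: walk_rev; [exact: series_adj_sym|exact: series_walk_across].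
    rewrite series_coord_lower series_coord_upper /=.
    by have := coord_le hw1 y [::]; lia.
  + have [k [t [kxy kt]]] := coord_walk hw2 x y; exists k, t.
    rewrite !series_coord_upper; split; first exact: series_walk_upper.
    by case: t kt => [|n t] //=; rewrite subnDl [_ + _ - _]subnDl.
Qed.

End series.

Section parallel.
Variables (G : tb_graph) (H D : nat) (w : vertex G -> seq nat -> nat).
Hypothesis hw : bundle_coordinates w H D.

(** Moves the coordinates of a graph of height [H] to those of its copy number
    [n]: the root keeps the height, and the new coordinate at [[:: n]] is the
    distance to the two ends, which vanishes at the ends and so is well defined
    after they are identified. *)
Definition branch_coord (n : nat) (f : seq nat -> nat) (t : seq nat) : nat :=
  match t with
  | [::] => f [::]
  | m :: t' => if m == n then
      if t' is [::] then minn (f [::]) (H - f [::]) else f t'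
    else 0
  end.

Definition parallel_coord (v : vertex (parallel_graph G)) : seq nat -> nat :=
  match v with
  | Bottom => w Bottom
  | Top => w Top
  | Inner (n, i) => branch_coord n (w (Inner i))
  end.

Lemma parallel_coord_copy n x t :
  parallel_coord (parallel_copy n x) t = branch_coord n (w x) t.
Proof.
case: x => //; case: t => [//|m [|k t]] /=.
- by rewrite !(coord_bottom hw) min0n if_same.
- by rewrite !(coord_bottom hw) if_same.
- by rewrite !(coord_top hw) subnn minn0 if_same.
- by rewrite !(coord_top hw) if_same.
Qed.

Lemma parallel_vertexP (v : vertex (parallel_graph G)) :
  exists n x, v = parallel_copy n x.
Proof.
case: v => [||[n i]].
- by exists 0, Bottom.
- by exists 0, Top.
- by exists n, (Inner i).
Qed.

Lemma parallel_walk n k x y : walk k x y ->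
  walk k (parallel_copy n x : vertex (parallel_graph G)) (parallel_copy n y).
Proof. by apply: walk_map => u v uv; exists n, u, v. Qed.

Lemma parallel_adj_sym (x y : vertex (parallel_graph G)) : adj x y -> adj y x.
Proof.
by case=> n [u [v [uv -> ->]]]; exists n, v, u; split=> //; exact: coord_adj_sym hw _ _ uv.
Qed.

(** The only place where the factor 3 is needed. For points at heights [a] and
    [b] in different copies the distance is the smaller of [a + b] and
    [(H - a) + (H - b)], and it is at most three times the largest of [a - b],
    [b - a], [minn a (H - a)] and [minn b (H - b)], which are differences of the
    coordinates at [[::]], [[:: n]] and [[:: m]]. *)
Lemma parallel_coordinates : bundle_coordinates parallel_coord H D.+1.
Proof.
split.
- exact: coord_bottom hw.
- exact: coord_top hw.
- move=> v t; have [n [x ->]] := parallel_vertexP v; rewrite parallel_coord_copy.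
  case: t => [|m [|k t]] /=; first exact: coord_le hw _ _.
    by case: ifP => // _; rewrite geq_min (coord_le hw).
  by case: ifP => // _; exact: coord_le hw _ _.
- move=> v t; have [n [x ->]] := parallel_vertexP v; rewrite parallel_coord_copy.
  by case: t => [|m [|k t]] //=; case: ifP => // _ /(coord_depth hw).
- move=> v; have [n [x ->]] := parallel_vertexP v.
  have [s hs] := coord_finite hw x; exists ([:: [::]; [:: n]] ++ map (cons n) s) => t.
  rewrite parallel_coord_copy; case: t => [|m [|k t]] //=.
    by case: (m =P n) => // -> _; rewrite !inE eqxx orbT.
  case: (m =P n) => // -> /hs h; rewrite !inE; apply/orP; right; apply/orP; right.
  exact: map_f.
- exact: parallel_adj_sym.
- move=> _ _ [n [x [y [xy -> ->]]]].
  have [L hL] := coord_adj hw xy.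
  exists (fun i => if i is j.+1 then L j else n) => t; rewrite !parallel_coord_copy.
  case: t => [|m t] /=; first by have [? ? _] := hL [::].
  case: (m =P n) => [->|_]; last by split.
  have [hx hy] := (coord_le hw x [::], coord_le hw y [::]).
  case: t => [|k t].
    by have [? ? _] := hL [::]; split=> //; lia.
  have [? ? h] := hL (k :: t); split=> // /h kt.
  by rewrite [size _]/= mkseq_cons [in LHS]kt.
- move=> v; have [n [x ->]] := parallel_vertexP v; rewrite parallel_coord_copy.
  exact: (parallel_walk n (coord_walk_bottom hw x)).
- move=> v; have [n [x ->]] := parallel_vertexP v; rewrite parallel_coord_copy.
  exact: (parallel_walk n (coord_walk_top hw x)).
- move=> u v; have [n [x ->]] := parallel_vertexP u; have [m [y ->]] := parallel_vertexP v.
  have [<-{m}|nm] := eqVneq n m.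
    have [k [t [kxy kt]]] := coord_walk hw x y.
    exists k, (if t is [::] then [::] else n :: t).
    rewrite !parallel_coord_copy; split; first exact: parallel_walk.
    by case: t kt => [|j t] //=; rewrite eqxx.
  set a := w x [::]; set b := w y [::].
  have [aH bH] := (coord_le hw x [::] : a <= H, coord_le hw y [::] : b <= H).
  have down : walk (a + b) (parallel_copy n x : vertex (parallel_graph G)) (parallel_copy m y).
    apply: walk_cat (parallel_walk m (coord_walk_bottom hw y)).
    apply: walk_rev; first exact: parallel_adj_sym.
    exact: (parallel_walk n (coord_walk_bottom hw x)).
  have up : walk ((H - a) + (H - b))
      (parallel_copy n x : vertex (parallel_graph G)) (parallel_copy m y).
    apply: walk_cat (parallel_walk n (coord_walk_top hw x)) _.
    apply: walk_rev; first exact: parallel_adj_sym.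
    exact: (parallel_walk m (coord_walk_top hw y)).
  have mn : (m == n) = false by rewrite eq_sym; exact: negbTE.
  have [k [kw kle]] : exists k,
      walk k (parallel_copy n x : vertex (parallel_graph G)) (parallel_copy m y) /\
      k <= minn (a + b) ((H - a) + (H - b)).
    by rewrite /minn; case: ifP => _; [exists (a + b)|exists ((H - a) + (H - b))].
  have : [|| k <= 3 * ((a - b) + (b - a)), k <= 3 * minn a (H - a) |
      k <= 3 * minn b (H - b)] by lia.
  case/or3P => hk.
  - by exists k, [::]; rewrite !parallel_coord_copy.
  - exists k, [:: n]; rewrite !parallel_coord_copy /= eqxx (negbTE nm).
    by rewrite subn0 sub0n addn0.
  - exists k, [:: m]; rewrite !parallel_coord_copy /= eqxx mn.
    by rewrite subn0 sub0n add0n.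
Qed.

End parallel.

Lemma bundle_construction_coordinates b (G : tb_graph) :
  bundle_construction b G ->
  exists (w : vertex G -> seq nat -> nat) (H D : nat), bundle_coordinates w H D.
Proof.
elim=> {b G}.
- by eexists; exists 1, 0; exact: unit_path_coordinates.
- move=> b1 b2 G1 G2 _ [w1 [H1 [D1 h1]]] _ [w2 [H2 [D2 h2]]].
  by exists (series_coord H1 w1 w2), (H1 + H2), (maxn D1 D2); exact: series_coordinates h1 h2.
- move=> b G _ [w [H [D h]]].
  by exists (parallel_coord H w), H, D.+1; exact: parallel_coordinates h.
Qed.

Lemma graph_dist_walk (G : tb_graph) k (x y : vertex G) : walk k x y ->
  walk (graph_dist x y) x y /\ graph_dist x y <= k.
Proof.
move=> kxy; rewrite /graph_dist; case: pselect => [ex|[]].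
  by case: ex_minnP => m /asboolP mxy mmin; split=> //; apply: mmin; exact/asboolP.
by exists k; exact/asboolP.
Qed.

End bundle_coordinates.

(** * Basic trees in the dual *)

Section basic_trees.
Context {R : realType} (X : normedModType R).
Implicit Types (t : seq nat) (l : seq (dual X)) (a : nat -> R).

Definition bounded_integers (N : nat) a : Prop :=
  forall i, exists2 k, (k <= N + N)%N & a i = k%:R - N%:R.

(** With bounded integer coefficients there are finitely many combinations, so
    picking one almost norming point for each of them is enough. *)
Lemma norming_finite (N : nat) (d : R) l : 0 < d ->
  exists F : seq X, forall a, bounded_integers N a ->
    exists p, [/\ p \in F, `|p| <= 1 &
      (1 - d) * `|lincomb a l| <= `|lincomb a l p|].
Proof.
move=> d0.
have /choice[np hnp] : forall u : dual X, exists p, `|p| <= 1 /\ (1 - d) * `|u| <= `|u p|.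
  by move=> u; have [p] := dual_norming u d0; exists p.
pose cf (f : {ffun 'I_(size l) -> 'I_(N + N).+1}) : dual X :=
  \sum_(i < size l) ((f i)%:R - N%:R) *: l`_i.
exists (map (np \o cf) (enum {ffun 'I_(size l) -> 'I_(N + N).+1})) => a ha.
have /choice[k hk] : forall i, exists k, (k <= N + N)%N /\ a i = k%:R - N%:R.
  by move=> i; have [k] := ha i; exists k.
pose f : {ffun 'I_(size l) -> 'I_(N + N).+1} := [ffun i : 'I_(size l) => inord (k i)].
have E : lincomb a l = cf f.
  apply: eq_bigr => i _; rewrite ffunE inordK; first by have [_ ->] := hk i.
  by have [] := hk i.
exists (np (lincomb a l)); have [h1 h2] := hnp (lincomb a l); split=> //.
by rewrite E; apply: (map_f (np \o cf)); rewrite mem_enum.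
Qed.

Lemma seq_dependent_choice (T : Type) (P : seq T -> Prop) :
  P [::] -> (forall s, P s -> exists x, P (rcons s x)) ->
  exists e : nat -> T, forall i, P (mkseq e i).
Proof.
move=> P0 PS; have [x0 _] := PS _ P0.
have /choice[f hf] : forall s, exists x, P s -> P (rcons s x).
  move=> s; have [/PS[x hx]|ns] := pselect (P s); [by exists x|by exists x0].
pose pre i := iter i (fun s => rcons s (f s)) [::].
exists (f \o pre) => i.
have -> : mkseq (f \o pre) i = pre i by elim: i => [//|i IH]; rewrite mkseqS IH.
by elim: i => [//|i IH]; exact: hf.
Qed.

Lemma ltn_code_child k t : (CodeSeq.code t < CodeSeq.code (k :: t))%N.
Proof.
rewrite /CodeSeq.code /= -/(CodeSeq.code t).
by have : (0 < 2 ^ k)%N by [rewrite expn_gt0]; nia.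
Qed.

(** Nodes of the tree are reversed sequences: the children of [t] are the
    [k :: t], whose codes exceed that of [t]. The vectors attached to the nodes
    can thus be chosen in the order of the codes, each after its ancestors. *)
Fixpoint branch_codes t : seq nat :=
  rcons (if t is k :: t' then branch_codes t' else [::]) (CodeSeq.code t).

Lemma branch_codes_le t i : i \in branch_codes t -> (i <= CodeSeq.code t)%N.
Proof.
elim: t => [|k t IH] /=; first by rewrite inE => /eqP->.
rewrite mem_rcons inE => /orP[/eqP->//|/IH h].
exact: leq_trans h (ltnW (ltn_code_child k t)).
Qed.

Lemma take_mkseq (T : Type) (e : nat -> T) i j : (i <= j)%N ->
  take i (mkseq e j) = mkseq e i.
Proof. by move=> ij; rewrite /mkseq -map_take take_iota (minn_idPl ij). Qed.

(** A vector for each code, so that the initial combinations with bounded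
    integer coefficients are almost normed by points killing all later vectors
    (this gives projections of norm almost 1), the nodes of depth at most [n]
    are normalized and the full branches have an upper c0-estimate. *)
Definition basic_tree (N n : nat) (d K : R) (e : nat -> dual X) : Prop :=
  [/\ forall i a, bounded_integers N a -> exists p,
        [/\ `|p| <= 1,
          (1 - d) * `|lincomb a (mkseq e i)| <= `|lincomb a (mkseq e i) p| &
          forall j, (i <= j)%N -> e j p = 0],
    forall t, (size t <= n)%N -> `|e (CodeSeq.code t)| = 1 &
    forall t, size t = n -> c0_upper K (map e (branch_codes t))].

(** The game is played along every branch at once: the vector of a new node
    answers, in the game of its parent, the union of the norming sets of all
    initial segments of the list built so far. *)
Lemma basic_tree_exists (N n : nat) (d K : R) : 0 < d ->
  annihilator_game (@c0_upper R X K) n.+1 [::] ->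
  exists e, basic_tree N n d K e.
Proof.
move=> d0 g0.
have /choice[F hF] : forall l, exists F : seq X, forall a, bounded_integers N a ->
    exists p, [/\ p \in F, `|p| <= 1 & (1 - d) * `|lincomb a l| <= `|lincomb a l p|].
  by move=> l; exact: norming_finite.
pose good l := forall j, (j < size l)%N ->
  (forall i, (i <= j)%N -> annihilator (F (take i l)) l`_j) /\
  ((size (CodeSeq.decode j) <= n)%N -> `|l`_j| = 1 /\
    annihilator_game (c0_upper K) (n - size (CodeSeq.decode j))
      (map (nth 0 l) (branch_codes (CodeSeq.decode j)))).
have [|l gl|e he] := @seq_dependent_choice _ good.
- by [].
- pose G := flatten [seq F (take i l) | i <- iota 0 (size l).+1].
  set t := CodeSeq.decode (size l).
  have ct : CodeSeq.code t = size l by rewrite /t CodeSeq.decodeK.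
  have [x [Gx hx]] : exists x, annihilator G x /\ ((size t <= n)%N -> `|x| = 1 /\
      annihilator_game (c0_upper K) (n - size t)
        (map (nth 0 (rcons l x)) (branch_codes t))).
    (* Nodes too deep for the game get the vector 0. *)
    have [tn|tn] := leqP (size t) n; last by exists 0.
    case: t ct tn => [|k t] ct tn.
      have [x [Gx x1 gx]] := g0 G; exists x; split=> // _; split=> //=.
      by rewrite subn0 nth_rcons -ct; case: (l) ct => //= _; exact: gx.
    have lt : (CodeSeq.code t < size l)%N by rewrite -ct ltn_code_child.
    have [_] := gl _ lt; rewrite CodeSeq.codeK => /(_ (ltnW tn))[_].
    have -> : (n - size t = (n - size (k :: t)).+1)%N by rewrite /= subnSK.
    move=> /(_ G)[x [Gx x1 gx]]; exists x; split=> // _; split=> //.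
    have -> : branch_codes (k :: t) =
      rcons (branch_codes t) (CodeSeq.code (k :: t)) by [].
    rewrite map_rcons nth_rcons ct ltnn eqxx.
    rewrite (_ : map _ _ = map (nth 0 l) (branch_codes t))//.
    apply/eq_in_map => i /branch_codes_le it.
    by rewrite nth_rcons (leq_ltn_trans it lt).
  exists x => j; rewrite size_rcons ltnS leq_eqVlt => /orP[/eqP->|jl].
    rewrite nth_rcons ltnn eqxx; split=> // i il.
    apply: annihilator_sub Gx => p pF.
    apply/flatten_mapP; exists i; first by rewrite mem_iota.
    by rewrite -cats1 takel_cat in pF.
  have [h1 h2] := gl j jl; rewrite nth_rcons jl; split.
    move=> i ij; rewrite -cats1 takel_cat ?(leq_trans ij (ltnW jl))//; exact: h1.
  move=> /h2[-> gj]; split=> //.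
  rewrite (_ : map _ _ = map (nth 0 l) (branch_codes (CodeSeq.decode j)))//.
  apply/eq_in_map => i /branch_codes_le; rewrite CodeSeq.decodeK => ij.
  by rewrite nth_rcons (leq_ltn_trans ij jl).
have {}he j : _ := he j.+1 j ltac:(by rewrite size_mkseq).
exists e; split.
- move=> i a ha; have [p [pF p1 pl]] := hF (mkseq e i) a ha.
  exists p; split=> // j ij; have [/(_ i ij) h _] := he j.
  rewrite nth_mkseq// take_mkseq ?(leq_trans ij)// in h; exact: h.
- move=> t tn; have [_] := he (CodeSeq.code t); rewrite CodeSeq.codeK => /(_ tn)[].
  by rewrite nth_mkseq.
- move=> t tn; have [_] := he (CodeSeq.code t).
  rewrite CodeSeq.codeK tn subnn => /(_ (leqnn n))[_].
  rewrite (_ : map _ _ = map e (branch_codes t))//.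
  by apply/eq_in_map => i /branch_codes_le it; rewrite nth_mkseq.
Qed.

(** One coordinate is the difference of two initial projections, whence the
    factor 2. *)
Lemma basic_tree_coef (N n : nat) (d K : R) e a j M : d <= 1 ->
  basic_tree N n d K e -> bounded_integers N a -> (j < M)%N ->
  (size (CodeSeq.decode j) <= n)%N ->
  (1 - d) * `|a j| <= 2 * `|lincomb a (mkseq e M)|.
Proof.
move=> d1 [hb h1 _] ha jM jn.
have part i : (i <= M)%N ->
    (1 - d) * `|lincomb a (mkseq e i)| <= `|lincomb a (mkseq e M)|.
  move=> iM; have [p [p1 hp pz]] := hb i a ha.
  apply: le_trans hp _; apply: le_trans (ler_dual_norm _ p1).
  have -> : mkseq e M = mkseq e i ++ mkseq (fun k => e (i + k)%N) (M - i).
    rewrite -{1}(subnKC iM) /mkseq iotaD map_cat add0n; congr (_ ++ _).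
    by rewrite -{1}[i]addn0 iotaDl -map_comp.
  rewrite lincomb_cat dualD (_ : lincomb _ (mkseq _ (M - i)) p = 0) ?addr0//.
  rewrite dual_sum big1// => k _; rewrite dualZ nth_mkseq; last first.
    by apply: leq_trans (ltn_ord k) _; rewrite size_mkseq.
  by rewrite pz ?leq_addr// mulr0.
have E : a j *: e j = lincomb a (mkseq e j.+1) - lincomb a (mkseq e j).
  by rewrite mkseqS lincomb_rcons size_mkseq addrAC subrr add0r.
have -> : `|a j| = `|a j *: e j|.
  by rewrite normrZ -[j in e j]CodeSeq.decodeK h1// mulr1.
have d0 : 0 <= 1 - d by rewrite subr_ge0.
rewrite E; apply: le_trans (ler_wpM2l d0 (ler_normB _ _)) _.
rewrite mulrDr; move: (part _ jM) (part _ (ltnW jM)); lra.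
Qed.

End basic_trees.

(** * The embedding *)

Section embedding.
Context {R : realType} (X : normedModType R).
Implicit Types (e : nat -> dual X) (a b : nat -> R).

Lemma lincombB a b (s : seq (dual X)) :
  lincomb (fun i => a i - b i) s = lincomb a s - lincomb b s.
Proof. by rewrite /lincomb -sumrB; apply: eq_bigr => i _; rewrite scalerBl. Qed.

Lemma lincomb_mkseq a e M :
  lincomb a (mkseq e M) = \sum_(j <- iota 0 M) a j *: e j.
Proof.
elim: M => [|M IH]; first by rewrite lincomb_nil big_nil.
by rewrite mkseqS lincomb_rcons size_mkseq IH -addn1 iotaD big_cat big_seq1.
Qed.

Lemma lincomb_mkseq_widen a e M M' : (M <= M')%N ->
  (forall j, (M <= j)%N -> a j = 0) ->
  lincomb a (mkseq e M') = lincomb a (mkseq e M).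
Proof.
move=> MM' aM; rewrite !lincomb_mkseq -(subnKC MM') iotaD big_cat/=.
rewrite add0n [X in _ + X]big_seq [X in _ + X]big1 ?addr0// => j.
by rewrite mem_iota => /andP[/aM-> _]; rewrite scale0r.
Qed.

Lemma lincomb_map a e (s : seq nat) :
  lincomb (fun i => a (nth 0%N s i)) (map e s) = \sum_(j <- s) a j *: e j.
Proof.
elim: s => [|j s IH]; first by rewrite lincomb_nil big_nil.
by rewrite big_cons lincomb_cons; congr (_ + _).
Qed.

Lemma branch_codes_uniq t : uniq (branch_codes t).
Proof.
elim: t => [//|k t IH]; rewrite [branch_codes _]/= rcons_uniq IH andbT.
apply/negP => /branch_codes_le; rewrite leqNgt; exact/negP/negPn/ltn_code_child.
Qed.

Lemma mem_branch_codes (L : nat -> nat) m D : (m <= D)%N ->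
  CodeSeq.code (rev (mkseq L m)) \in branch_codes (rev (mkseq L D)).
Proof.
elim: D => [|D IH]; first by rewrite leqn0 => /eqP->; rewrite inE.
rewrite leq_eqVlt ltnS mkseqS rev_rcons => /orP[/eqP->|/IH h].
  by rewrite mkseqS rev_rcons [branch_codes _]/= mem_rcons mem_head.
by rewrite [branch_codes _]/= mem_rcons inE h orbT.
Qed.

(** The vertex [x] goes to the combination of the tree with coefficients [w x].
    An edge changes the coefficients by at most 1 along one branch, so its image
    is bounded by the c0-constant [K] and a walk by [K] times its length. From
    below, some coefficient of a difference is at least a third of the distance,
    and [basic_tree_coef] bounds it by twice the norm. *)
Lemma bundle_graph_embedding (G : tb_graph) w H D (K d : R) :
  0 < d -> d < 1 ->
  @bundle_coordinates G w H D ->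
  annihilator_game (@c0_upper R X K) D.+1 [::] ->
  exists f : vertex G -> dual X, forall x y,
    (1 - d) / 6 * (graph_dist x y)%:R <= `|f x - f y| /\
    `|f x - f y| <= K * (graph_dist x y)%:R.
Proof.
move=> d0 d1 hw g0; have [e he] := basic_tree_exists H d0 g0.
pose al x j : R := (w x (rev (CodeSeq.decode j)))%:R.
have /choice[B hB] : forall x, exists M, forall j, (M <= j)%N -> al x j = 0.
  move=> x; have [s hs] := coord_finite hw x.
  exists (\max_(t <- s) (CodeSeq.code (rev t)).+1) => j sj.
  rewrite /al; have [->//|/hs js] := eqVneq (w x (rev (CodeSeq.decode j))) 0%N.
  have := leq_trans (leq_bigmax_seq (F := fun t => (CodeSeq.code (rev t)).+1) _ js isT) sj.
  by rewrite revK CodeSeq.decodeK ltnn.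
pose f x := lincomb (al x) (mkseq e (B x)).
pose ga x y j := al x j - al y j.
have fB x y M : (maxn (B x) (B y) <= M)%N -> f x - f y = lincomb (ga x y) (mkseq e M).
  rewrite geq_max => /andP[xM yM]; rewrite lincombB.
  by rewrite (lincomb_mkseq_widen e xM (hB x)) (lincomb_mkseq_widen e yM (hB y)).
have gaH x y : bounded_integers H (ga x y).
  move=> j; exists (w x (rev (CodeSeq.decode j)) + (H - w y (rev (CodeSeq.decode j))))%N.
    by apply: leq_add (leq_subr _ _); exact: coord_le hw _ _.
  rewrite natrD natrB ?(coord_le hw)// /ga /al; ring.
have edge x y : adj x y -> `|f x - f y| <= K.
  move=> /(coord_adj hw)[L hL].
  pose t0 := rev (mkseq L D).
  (* Long enough to contain both supports and the whole branch to [t0]. *)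
  pose M := maxn (maxn (B x) (B y)) (CodeSeq.code t0).+1.
  have ga0 j : ga x y j != 0 -> j \in branch_codes t0.
    set t := rev (CodeSeq.decode j) => gaj.
    have wxy : w x t != w y t.
      by apply: contra gaj => /eqP E; rewrite /ga /al -/t E subrr.
    have [_ _ /(_ wxy) tE] := hL t.
    have tD : (size t <= D)%N.
      have [x0|] := eqVneq (w x t) 0%N; last exact: coord_depth hw _ _.
      by apply: (coord_depth hw (x := y)); rewrite -x0 eq_sym.
    by rewrite -[j]CodeSeq.decodeK -[CodeSeq.decode j]revK -/t tE mem_branch_codes.
  rewrite (@fB x y M) ?leq_maxl// lincomb_mkseq.
  have -> : \sum_(j <- iota 0 M) ga x y j *: e j =
      \sum_(j <- branch_codes t0) ga x y j *: e j.
    rewrite (bigID (fun j => j \in branch_codes t0))/= [X in _ + X]big1 ?addr0.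
      rewrite -big_filter; apply: perm_big; apply: uniq_perm.
      - by rewrite filter_uniq ?iota_uniq.
      - exact: branch_codes_uniq.
      - move=> j; rewrite mem_filter mem_iota/= add0n; case: (boolP (j \in _)) => //= jt.
        by apply: leq_trans (leq_maxr _ _); rewrite ltnS branch_codes_le.
    by move=> j jt; have [->|/ga0] := eqVneq (ga x y j) 0; [rewrite scale0r|rewrite (negbTE jt)].
  rewrite -lincomb_map; have [_ _ hK] := he; apply: hK.
    by rewrite size_rev size_mkseq.
  move=> i; have [h1 h2 _] := hL (rev (CodeSeq.decode (nth 0%N (branch_codes t0) i))).
  rewrite /ga /al ler_norml lerBlDr -lerBlDl; rewrite -!(ler_nat R) -!natr1 in h1 h2.
  by apply/andP; split; lra.
exists f => x y.
have [k [t [kxy kt]]] := coord_walk hw x y.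
have [wk dk] := graph_dist_walk kxy.
split; last first.
  move: (graph_dist x y) wk {kxy kt dk} => m; elim: m x => [|m IH] x /=.
    by move=> ->; rewrite subrr normr0 mulr0.
  case=> z xz /IH h; rewrite -(subrKA (f z)); apply: le_trans (ler_normD _ _) _.
  by rewrite -natr1 mulrDr mulr1 addrC; apply: lerD => //; exact: edge.
have [E|ne] := eqVneq (w x t) (w y t).
  by move: (leq_trans dk kt); rewrite E subnn leqn0 => /eqP->; rewrite mulr0.
pose j := CodeSeq.code (rev t).
have jt : rev (CodeSeq.decode j) = t by rewrite CodeSeq.codeK revK.
pose M := maxn (maxn (B x) (B y)) j.+1.
rewrite (@fB x y M) ?leq_maxl//.
have jD : (size (CodeSeq.decode j) <= D)%N.
  rewrite CodeSeq.codeK size_rev.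
  have [x0|] := eqVneq (w x t) 0%N; last exact: coord_depth hw _ _.
  by apply: (coord_depth hw (x := y)); rewrite -x0 eq_sym.
have := basic_tree_coef (ltW d1) he (gaH x y) (leq_maxr _ _ : (j < M)%N) jD.
set u := `|lincomb _ _|; rewrite /ga /al jt => hu.
have : (graph_dist x y)%:R <= 3 * `|(w x t)%:R - (w y t)%:R : R|.
  apply: (@le_trans _ _ k%:R); first by rewrite ler_nat.
  move: kt; rewrite -(ler_nat R) natrM natrD => /le_trans; apply.
  rewrite ler_pM2l//; have [xy|yx] := leqP (w x t) (w y t).
    rewrite distrC -natrB// (eqP (_ : w x t - w y t == 0)%N) ?subn_eq0// add0r.
    by rewrite ger0_norm.
  rewrite -natrB ?(ltnW yx)// (eqP (_ : w y t - w x t == 0)%N) ?subn_eq0 ?(ltnW yx)//.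
  by rewrite addr0 ger0_norm.
have d10 : 0 <= 1 - d by rewrite subr_ge0 ltW.
move=> /(ler_wpM2l d10); move: hu.
set q := `|_ - _|; set g := (graph_dist x y)%:R; lra.
Qed.

End embedding.

Theorem theoremA (R : realType) (X : completeNormedModType R)
    (X_separable : separable_space X)
    (X_szlenk : olt_oo (Some omega) (szlenk_index X))
    (X_asymptotic : weak_star_unconditional_asymptotic_structure X)
    (e : R) (e_gt0 : 0 < e)
    (G : tb_graph) (G_bundle : nontrivial_bundle_graph G) :
  exists (f : vertex G -> dual X) (D : R),
    D < 6 + e /\
    distortion_at_most (fun x y => (graph_dist x y)%:R) f D.
Proof.
have [w [H [D hw]]] := bundle_construction_coordinates G_bundle.
have [K hK] := annihilator_game_c0_bounded X_szlenk X_asymptotic.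
have e13 : 0 < 13 + e by rewrite addr_gt0.
(* [6 * (1 + d) / (1 - d) < 6 + e] amounts to [(12 + e) * d < e]. *)
pose d := e / (13 + e).
have d0 : 0 < d by rewrite divr_gt0.
have d1 : d < 1 by rewrite ltr_pdivrMr// mul1r ltrDr.
have hD := annihilator_game_c0_almost_isometric d0 hK (ltn0Sn D).
have [f hf] := bundle_graph_embedding d0 d1 hw hD.
have d1' : 0 < 1 - d by rewrite subr_gt0.
exists f, (6 * (1 + d) / (1 - d)); split.
  have de : d * (13 + e) = e by rewrite divfK// gt_eqF.
  by rewrite ltr_pdivrMr//; nra.
exists ((1 - d) / 6); first by rewrite divr_gt0.
move=> x y; have -> : (1 - d) / 6 * (6 * (1 + d) / (1 - d)) = 1 + d.
  by field; rewrite gt_eqF.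
exact: hf.
Qed.
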